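(* Let $R[x;\sigma,\delta]$ be an Ore extension. Let $M$ be an $R[x;\sigma,\delta]$-module for which $M^\sigma\cong M$ as $R$-modules, and fix an isomorphism of $R$-modules $\phi:M\to M^\sigma$. Consider a projective resolution $P_\bullet(M)$ of $M$ as an $R$-module and suppose that each map $\sigma_i:P_i(M)\to P_i(M)$ is bijective, where $\sigma_\bullet:P_\bullet(M)\to P_\bullet(M)$ is a $k$-linear chain map obtained from an $R$-module chain map $P_\bullet(M)\to P^\sigma_\bullet(M)$ lifting the identity map $M\to M$. For each $i\ge 0$, set $$Y_{i,0}=Y_{i,1}=P_i(M)\otimes k[x]\quad\text{and}\quad Y_{i,j}=0\ \text{ for all } j>1,$$ with the $R[x;\sigma,\delta]$-module structure and differentials of the twisted product complex of $P_\bullet(M)$ with the Koszul resolution of $k$ over $k[x]$. Then the total complex $Y_\bullet$, $Y_n=\bigoplus_{i+j=n}Y_{i,j}$, is a projective resolution of $M$ as an $R[x;\sigma,\delta]$-module.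
   Context: $k$ is a field of arbitrary characteristic, $\otimes=\otimes_k$, algebras are associative unital $k$-algebras, modules are left modules. Ore extension: $R$ is a $k$-algebra, $\sigma$ a $k$-algebra automorphism of $R$, $\delta:R\to R$ a left $\sigma$-derivation ($k$-linear with $\delta(rs)=\delta(r)s+\sigma(r)\delta(s)$). $R[x;\sigma,\delta]$ is the algebra with underlying vector space $R[x]$ and multiplication determined by that of $R$ and of $k[x]$ and $xr=\sigma(r)x+\delta(r)$ for $r\in R$. With $A=R$, $B=k[x]$, it is the twisted tensor product $A\otimes_\tau B$ (the vector space $A\otimes B$ with multiplication $(m_A\otimes m_B)(1\otimes\tau\otimes 1)$), where $\tau:B\otimes A\to A\otimes B$ is the twisting map determined by $\tau(x\otimes r)=\sigma(r)\otimes x+\delta(r)\otimes 1$. For an $R$-module $M$, $M^\sigma$ is the vector space $M$ with $R$-action $r\cdot_\sigma m=\sigma(r)m$. Let $\cdots\to P_1(M)\xrightarrow{d_1}P_0(M)\xrightarrow{\mu}M\to 0$ be the given $R$-projective resolution and $P_i^\sigma(M)=(P_i(M))^\sigma$; then $P_\bullet^\sigma(M)$ with the same differentials and augmentation $\phi^{-1}\mu:P_0^\sigma(M)\to M$ is also an $R$-projective resolution of $M$. An $R$-module chain map $P_\bullet(M)\to P^\sigma_\bullet(M)$ lifting the identity of $M$ is viewed as a $k$-linear chain map $\sigma_\bullet:P_\bullet(M)\to P_\bullet(M)$; thus $\sigma_i(rz)=\sigma(r)\sigma_i(z)$ and $\mu\sigma_0=\phi\mu$. Let $f:M\to M$ be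 the action of $x$ on $M$, and let $\delta_\bullet:P_\bullet(M)\to P_\bullet(M)$ be a $k$-linear chain map lifting $f$ such that $\delta_i(rz)=\sigma(r)\delta_i(z)+\delta(r)z$ for all $i\ge0$, $r\in R$, $z\in P_i(M)$ (such chain maps exist). Define $\tau_{B,i}:B\otimes P_i(M)\to P_i(M)\otimes B$ by $\tau_{B,i}(1\otimes z)=z\otimes 1$, $\tau_{B,i}(x\otimes z)=\sigma_i(z)\otimes x+\delta_i(z)\otimes 1$, extended to all powers of $x$ by $\tau_{B,i}(m_B\otimes 1)=(1\otimes m_B)(\tau_{B,i}\otimes 1)(1\otimes\tau_{B,i})$. Twisted product structure: the Koszul resolution of $k$ over $B=k[x]$ is $0\to k[x]\xrightarrow{x\cdot}k[x]\xrightarrow{\epsilon}k\to 0$, $\epsilon(x)=0$. Each $Y_{i,j}$ ($j=0,1$) is an $R[x;\sigma,\delta]=A\otimes_\tau B$-module via $(\rho\otimes m_B)(1\otimes\tau_{B,i}\otimes 1):(A\otimes B)\otimes P_i(M)\otimes k[x]\to P_i(M)\otimes k[x]$, where $\rho:A\otimes P_i(M)\to P_i(M)$ is the $R$-action. The differentials are $d_i\otimes 1:Y_{i,j}\to Y_{i-1,j}$ and $(-1)^i\,1\otimes(x\cdot):Y_{i,1}\to Y_{i,0}$, and the augmentation is $\mu\otimes\epsilon:Y_0=P_0(M)\otimes k[x]\to M\otimes k\cong M$. *)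

(* Defs.v *)
From HB Require Import structures.
From mathcomp Require Import all_boot all_order all_algebra.
From mathcomp Require Import boolp.
Set Implicit Arguments.
Unset Strict Implicit.
Unset Printing Implicit Defensive.
Import GRing.Theory.
Local Open Scope ring_scope.

(* [restrict f M] is the B-module M with A acting through f : A -> B.  For an *)
(* automorphism f = sigma of R, this is the twisted module M^sigma.           *)
Definition restrict (A B : pzRingType) (f : {rmorphism A -> B})
  (M : lmodType B) : Type := M.

Section Restrict.
Variables (A B : pzRingType) (f : {rmorphism A -> B}).

HB.instance Definition _ (M : lmodType B) := GRing.Zmodule.on (restrict f M).

Section Scale.
Variable M : lmodType B.
Let scale (a : A) (m : restrict f M) : restrict f M := f a *: (m : M).

Fact restrict_scalerA a b m : scale a (scale b m) = scale (a * b) m.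
Proof. by rewrite /scale scalerA rmorphM. Qed.
Fact restrict_scale1r : left_id 1 scale.
Proof. by move=> m; rewrite /scale rmorph1 scale1r. Qed.
Fact restrict_scalerDr : right_distributive scale +%R.
Proof. by move=> a m n; apply: scalerDr. Qed.
Fact restrict_scalerDl m : {morph scale^~ m : a b / a + b}.
Proof. by move=> a b; rewrite /scale rmorphD scalerDl. Qed.

HB.instance Definition _ := GRing.Zmodule_isLmodule.Build A (restrict f M)
  restrict_scalerA restrict_scale1r restrict_scalerDr restrict_scalerDl.

Lemma restrictZ a (m : restrict f M) : a *: m = f a *: (m : M).
Proof. by []. Qed.
End Scale.

Section Map.
Variables (M N : lmodType B) (h : {linear M -> N}).
Definition restrict_map : restrict f M -> restrict f N := h.
Fact restrict_map_is_linear : linear restrict_map.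
Proof. by move=> a x y; rewrite !restrictZ /restrict_map linearP. Qed.
HB.instance Definition _ := GRing.isLinear.Build A (restrict f M)
  (restrict f N) _ restrict_map restrict_map_is_linear.
End Map.
End Restrict.
Arguments restrict_map {A B} f {M N} h.

(* The vector space underlying a module over a k-algebra R. *)
Notation vspace_of R M := (restrict (in_alg R) M).
Definition vspace_map (k : fieldType) (R : algType k) (M N : lmodType R)
    (h : {linear M -> N}) : {linear vspace_of R M -> vspace_of R N} :=
  restrict_map (in_alg R) h.

Definition projective (S : nzRingType) (Q : lmodType S) : Prop :=
  forall (N N' : lmodType S) (g : {linear N -> N'}) (h : {linear Q -> N'}),
    (forall y, exists x, g x = y) ->
    exists h' : {linear Q -> N}, forall q, g (h' q) = h q.

(* [d i] is the differential Q_(i+1) -> Q_i, [e] the augmentation Q_0 -> M. *)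
Definition projective_resolution (S : nzRingType) (M : lmodType S)
    (Q : nat -> lmodType S) (d : forall i, Q i.+1 -> Q i) (e : Q 0%N -> M) :
    Prop :=
  [/\ forall i, projective (Q i),
      linear e /\ (forall i, linear (d i)),
      forall m, exists z, e z = m,
      forall z, e z = 0 <-> exists w, d 0%N w = z
    & forall i z, d i z = 0 <-> exists w, d i.+1 w = z].

(* Tensor products of vector spaces.  Elements are classes of formal sums of  *)
(* pairs [:: (v_1, w_1); ...; (v_n, w_n)]; two sums are identified when all   *)
(* bilinear maps agree on them.  The bilinearity of [tensor] and the          *)
(* universal property ([tliftE], [tlift_uniq]) are proved below.              *)

Section Tensor.
Variables (k : fieldType) (V W : lmodType k).

Definition teval (U : lmodType k) (f : V -> W -> U) (s : seq (V * W)) : U :=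
  \sum_(x <- s) f x.1 x.2.

Definition teq (s t : seq (V * W)) : bool :=
  `[< forall (U : lmodType k) (f : {bilinear V -> W -> U}),
        teval f s = teval f t >].

Fact teq_refl : reflexive teq. Proof. by move=> s; apply/asboolP. Qed.
Fact teq_sym : symmetric teq.
Proof. by move=> s t; apply/asboolP/asboolP => h U f; rewrite h. Qed.
Fact teq_trans : transitive teq.
Proof.
by move=> t s u /asboolP h1 /asboolP h2; apply/asboolP => U f; rewrite h1 h2.
Qed.

Canonical teq_equiv := EquivRel teq teq_refl teq_sym teq_trans.

Definition tprod : Type := {eq_quot teq_equiv}%qT.
HB.instance Definition _ := Choice.on tprod.

Definition tclass (s : seq (V * W)) : tprod := (\pi_{eq_quot teq_equiv} s)%qT.
Definition tensor (v : V) (w : W) : tprod := tclass [:: (v, w)].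
Let trepr (t : tprod) : seq (V * W) := repr (t : {eq_quot teq_equiv}%qT).

Definition tlift (U : lmodType k) (f : {bilinear V -> W -> U}) (t : tprod) : U :=
  teval f (trepr t).

Fact treprK t : tclass (trepr t) = t. Proof. exact: reprK. Qed.

Fact tclassP s t : (forall (U : lmodType k) (f : {bilinear V -> W -> U}),
  teval f s = teval f t) <-> tclass s = tclass t.
Proof.
split=> [h|h]; first by apply/eqquotP/asboolP.
by move/eqquotP/asboolP: h.
Qed.

Fact tlift_class (U : lmodType k) (f : {bilinear V -> W -> U}) s : tlift f (tclass s) = teval f s.
Proof. by move: U f; apply/tclassP; rewrite treprK. Qed.

Fact teval_cat (U : lmodType k) (f : V -> W -> U) s t :
  teval f (s ++ t) = teval f s + teval f t.
Proof. exact: big_cat. Qed.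

Let tadd a b := tclass (trepr a ++ trepr b).
Let tzero := tclass [::].
Let tscale (c : k) a := tclass [seq (c *: x.1, x.2) | x <- trepr a].
Let topp := tscale (-1).

Fact teval_scale (U : lmodType k) (f : {bilinear V -> W -> U}) c (s : seq (V * W)) :
  teval f [seq (c *: x.1, x.2) | x <- s] = c *: teval f s.
Proof.
by rewrite /teval big_map scaler_sumr; apply: eq_bigr => x _ /=; rewrite linearZl_LR.
Qed.

Fact tprodP (a b : tprod) :
  (forall (U : lmodType k) (f : {bilinear V -> W -> U}), tlift f a = tlift f b) ->
  a = b.
Proof. by move=> h; rewrite -(treprK a) -(treprK b); apply/tclassP => U f; apply: h. Qed.

Fact tlift_add (U : lmodType k) (f : {bilinear V -> W -> U}) a b :
  tlift f (tadd a b) = tlift f a + tlift f b.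
Proof. by rewrite tlift_class teval_cat. Qed.
Fact tlift_zero (U : lmodType k) (f : {bilinear V -> W -> U}) : tlift f tzero = 0.
Proof. by rewrite tlift_class /teval big_nil. Qed.
Fact tlift_scale (U : lmodType k) (f : {bilinear V -> W -> U}) c a :
  tlift f (tscale c a) = c *: tlift f a.
Proof. by rewrite tlift_class teval_scale. Qed.

Fact taddA : associative tadd.
Proof. by move=> a b c; apply: tprodP => U f; rewrite !tlift_add addrA. Qed.
Fact taddC : commutative tadd.
Proof. by move=> a b; apply: tprodP => U f; rewrite !tlift_add addrC. Qed.
Fact tadd0 : left_id tzero tadd.
Proof. by move=> a; apply: tprodP => U f; rewrite !tlift_add tlift_zero add0r. Qed.
Fact taddN : left_inverse tzero topp tadd.
Proof.
by move=> a; apply: tprodP => U f;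
   rewrite tlift_add tlift_scale tlift_zero scaleN1r addNr.
Qed.
HB.instance Definition _ := GRing.isZmodule.Build tprod taddA taddC tadd0 taddN.

Fact tscalerA a b m : tscale a (tscale b m) = tscale (a * b) m.
Proof. by apply: tprodP => U f; rewrite !tlift_scale scalerA. Qed.
Fact tscale1r : left_id 1 tscale.
Proof. by move=> m; apply: tprodP => U f; rewrite tlift_scale scale1r. Qed.
Fact tscalerDr : right_distributive tscale +%R.
Proof.
by move=> a m n; apply: tprodP => U f; rewrite tlift_scale !tlift_add !tlift_scale scalerDr.
Qed.
Fact tscalerDl m : {morph tscale^~ m : a b / a + b}.
Proof.
by move=> a b; apply: tprodP => U f; rewrite tlift_add !tlift_scale scalerDl.
Qed.
HB.instance Definition _ :=
  GRing.Zmodule_isLmodule.Build k tprod tscalerA tscale1r tscalerDr tscalerDl.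

Fact tlift_is_linear (U : lmodType k) (f : {bilinear V -> W -> U}) : linear (tlift f).
Proof. by move=> c a b; rewrite tlift_add tlift_scale. Qed.
HB.instance Definition _ (U : lmodType k) (f : {bilinear V -> W -> U}) :=
  GRing.isLinear.Build k tprod U _ (tlift f) (tlift_is_linear f).

Lemma tliftE (U : lmodType k) (f : {bilinear V -> W -> U}) v w :
  tlift f (tensor v w) = f v w.
Proof. by rewrite tlift_class /teval big_seq1. Qed.

Fact tensor_is_bilinear : bilinear_for *:%R *:%R tensor.
Proof.
split=> [w c v v'|v c w w']; apply: tprodP => U f;
  rewrite tlift_is_linear !tliftE ?linearPr //.
exact: (linearPl f).
Qed.
HB.instance Definition _ :=
  bilinear_isBilinear.Build k V W tprod *:%R *:%R tensor tensor_is_bilinear.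

Lemma tprod_sum (t : tprod) : exists s : seq (V * W), t = \sum_(x <- s) tensor x.1 x.2.
Proof.
exists (trepr t); apply: tprodP => U f; rewrite linear_sum /= /tlift.
by apply: eq_bigr => x _; rewrite -/(tlift f _) tliftE.
Qed.

Lemma tlift_uniq (U : lmodType k) (g h : {linear tprod -> U}) :
  (forall v w, g (tensor v w) = h (tensor v w)) -> g =1 h.
Proof.
by move=> gh t; have [s ->] := tprod_sum t; rewrite !linear_sum; apply: eq_bigr.
Qed.

End Tensor.

Section TensorMap.
Variables (k : fieldType) (V V' W W' : lmodType k).
Variables (f : {linear V -> V'}) (g : {linear W -> W'}).

Let pure (v : V) (w : W) : tprod V' W' := tensor (f v) (g w).
Fact tensor_map_pure_bilinear : bilinear_for *:%R *:%R pure.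
Proof.
split=> [w c v v'|v c w w']; rewrite /pure linearP ?linearPr //.
exact: (linearPl (@tensor k V' W')).
Qed.
HB.instance Definition _ :=
  bilinear_isBilinear.Build k V W _ *:%R *:%R pure tensor_map_pure_bilinear.

(* The map f (x) g *)
Definition tensor_map : tprod V W -> tprod V' W' := tlift pure.
HB.instance Definition _ := GRing.Linear.on tensor_map.

Lemma tensor_mapE v w : tensor_map (tensor v w) = tensor (f v) (g w).
Proof. exact: tliftE. Qed.
End TensorMap.

Record skew_derivation (k : fieldType) (R : algType k)
    (sigma : {lrmorphism R -> R}) := SkewDerivation {
  der :> {linear R -> R};
  derM : forall r s, der (r * s) = der r * s + sigma r * der s
}.

Section SkewAction.
Variables (k : fieldType) (R : algType k) (sigma : {lrmorphism R -> R}).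
Variable delta : skew_derivation sigma.

Lemma der1 : delta 1 = 0.
Proof.
have := derM delta 1 1; rewrite !mulr1 rmorph1 mul1r => /eqP.
by rewrite -subr_eq0 opprD addNKr oppr_eq0 => /eqP.
Qed.

Lemma der_alg (a : k) : delta a%:A = 0.
Proof. by rewrite linearZ /= der1 scaler0. Qed.

Variables (N : lmodType R) (T : {additive N -> N}).

(* (\sum_i r_i x^i) . y, when x acts on the R-module N by T *)
Definition skew_act (p : {poly R}) (y : N) : N :=
  \sum_(i < size p) p`_i *: iter i T y.

Lemma skew_act_wide n (p : {poly R}) y : (size p <= n)%N ->
  skew_act p y = \sum_(i < n) p`_i *: iter i T y.
Proof.
move=> le_n; rewrite /skew_act (big_ord_widen n (fun i => p`_i *: iter i T y)) //.
rewrite big_mkcond; apply: eq_bigr => i _; case: ltnP => // le_i.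
by rewrite nth_default // scale0r.
Qed.

Lemma skew_actD p q y : skew_act (p + q) y = skew_act p y + skew_act q y.
Proof.
pose n := maxn (size p) (size q).
rewrite (@skew_act_wide n (p + q)) ?size_polyD //.
rewrite (@skew_act_wide n p) ?leq_maxl // (@skew_act_wide n q) ?leq_maxr //.
by rewrite -big_split; apply: eq_bigr => i _; rewrite coefD scalerDl.
Qed.

Lemma skew_act0 y : skew_act 0 y = 0.
Proof. by rewrite /skew_act size_poly0 big_ord0. Qed.

Lemma iter_additive i y z : iter i T (y + z) = iter i T y + iter i T z.
Proof. by elim: i => //= i ->; rewrite raddfD. Qed.

Lemma skew_actDr p y z : skew_act p (y + z) = skew_act p y + skew_act p z.
Proof.
by rewrite -big_split; apply: eq_bigr => i _; rewrite iter_additive scalerDr.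
Qed.

Lemma skew_act0r p : skew_act p 0 = 0.
Proof. by apply: (addIr (skew_act p 0)); rewrite -skew_actDr !add0r. Qed.

Lemma skew_actC r y : skew_act r%:P y = r *: y.
Proof.
by rewrite (@skew_act_wide 1) ?size_polyC_leq1 // big_ord1 coefC.
Qed.

Lemma skew_actZ r p y : skew_act (r *: p) y = r *: skew_act p y.
Proof.
rewrite (skew_act_wide _ (size_scale_leq r p)) scaler_sumr.
by apply: eq_bigr => i _; rewrite coefZ scalerA.
Qed.

Lemma skew_actXn n y : skew_act 'X^n y = iter n T y.
Proof.
rewrite (@skew_act_wide n.+1) ?size_polyXn // big_ord_recr /= big1 => [|i _].
  by rewrite add0r coefXn eqxx scale1r.
by rewrite coefXn ltn_eqF // scale0r.
Qed.

(* Left multiplication by x in R[x; sigma, delta] *)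
Definition ore_shift (q : {poly R}) : {poly R} :=
  map_poly sigma q * 'X + map_poly delta q.

Fact ore_shift_is_additive : zmod_morphism ore_shift.
Proof. by move=> p q; rewrite /ore_shift !raddfB /= mulrBl addrACA -opprD. Qed.
HB.instance Definition _ :=
  GRing.isZmodMorphism.Build {poly R} {poly R} ore_shift ore_shift_is_additive.

Lemma ore_shiftZ r q : ore_shift (r *: q) = sigma r *: ore_shift q + delta r *: q.
Proof.
apply/polyP=> i; rewrite /ore_shift !(coefD, coefZ, coefMX, coef_map) /=.
rewrite derM mulrDr -!addrA [delta r * _ + _]addrC; congr (_ + _).
by case: (i == 0)%N; rewrite ?mulr0 // rmorphM.
Qed.

Lemma ore_shiftXn n : ore_shift 'X^n = 'X^(n.+1).
Proof.
apply/polyP=> i; rewrite /ore_shift map_polyXn -exprSr coefD coef_map !coefXn /=.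
by case: (i == n)%N; rewrite ?der1 ?raddf0 addr0.
Qed.

Hypothesis TZ : forall r y, T (r *: y) = sigma r *: T y + delta r *: y.

Lemma skew_act_shift q y : skew_act (ore_shift q) y = T (skew_act q y).
Proof.
have Tsum : T (skew_act q y) =
  \sum_(i < size q) (sigma q`_i *: iter i.+1 T y + delta q`_i *: iter i T y).
  by rewrite raddf_sum; apply: eq_bigr => i _; rewrite TZ.
rewrite Tsum skew_actD big_split; congr (_ + _); last first.
  rewrite (@skew_act_wide (size q)) ?size_poly //.
  by apply: eq_bigr => i _; rewrite coef_map.
rewrite (@skew_act_wide (size q).+1); last first.
  by rewrite (leq_trans (size_polyMleq _ _)) // size_polyX addn2 /= ltnS size_poly.
rewrite big_ord_recl coefMX eqxx scale0r add0r.
by apply: eq_bigr => i _; rewrite coefMX /= coef_map.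
Qed.

End SkewAction.

Section OreRing.
Variables (k : fieldType) (R : algType k) (sigma : {lrmorphism R -> R}).

(* R[x; sigma, delta]: polynomials \sum_i r_i x^i with coefficients on the    *)
(* left and x r = sigma(r) x + delta(r).                                      *)
Definition ore (delta : skew_derivation sigma) : Type := {poly R}.

Variable delta : skew_derivation sigma.
HB.instance Definition _ := GRing.Zmodule.on (ore delta).

Let mul (p q : ore delta) : ore delta := skew_act (ore_shift delta) p q.
Let one : ore delta := (1 : {poly R}).

Lemma skew_act_mul (N : lmodType R) (T : {additive N -> N})
  (TZ : forall r y, T (r *: y) = sigma r *: T y + delta r *: y) p q y :
  skew_act T (mul p q) y = skew_act T p (skew_act T q y).
Proof.
have Dsum (I : finType) (F : I -> {poly R}) :
    skew_act T (\sum_i F i) y = \sum_i skew_act T (F i) y.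
  exact: (big_morph (fun p => skew_act T p y)
    (fun p1 p2 => skew_actD T p1 p2 y) (skew_act0 T y)).
rewrite /mul [skew_act (ore_shift _) p q]/skew_act Dsum; apply: eq_bigr => i _.
rewrite skew_actZ; congr (_ *: _).
by elim: (nat_of_ord i) => //= n <-; rewrite (skew_act_shift TZ).
Qed.

Fact ore_mulA : associative mul.
Proof. by move=> p q r; apply: esym; apply: skew_act_mul; apply: ore_shiftZ. Qed.
Fact ore_mul1r : left_id one mul.
Proof. by move=> p; rewrite /mul skew_actC scale1r. Qed.
Fact ore_mulr1 : right_id one mul.
Proof.
move=> p; rewrite /mul /skew_act -[RHS]coefK poly_def; apply: eq_bigr => i _.
congr (_ *: _); elim: (nat_of_ord i) => //= n ->.
exact: ore_shiftXn.
Qed.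
Fact ore_mulDl : left_distributive mul +%R.
Proof. by move=> p q r; apply: skew_actD. Qed.
Fact ore_mulDr : right_distributive mul +%R.
Proof. by move=> p q r; apply: skew_actDr. Qed.
Fact ore_oner_neq0 : one != 0.
Proof. exact: oner_neq0. Qed.
HB.instance Definition _ := GRing.Zmodule_isNzRing.Build (ore delta)
  ore_mulA ore_mul1r ore_mulr1 ore_mulDl ore_mulDr ore_oner_neq0.

Definition oreC (r : R) : ore delta := r%:P.
Definition oreX : ore delta := 'X.

Fact oreC_is_zmod_morphism : zmod_morphism oreC.
Proof. exact: raddfB. Qed.
Fact oreC_is_monoid_morphism : monoid_morphism oreC.
Proof.
split=> // r s; apply: etrans (esym (skew_actC (ore_shift delta) r s%:P)).
by rewrite /oreC polyCM mul_polyC.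
Qed.
HB.instance Definition _ :=
  GRing.isZmodMorphism.Build R (ore delta) oreC oreC_is_zmod_morphism.
HB.instance Definition _ :=
  GRing.isMonoidMorphism.Build R (ore delta) oreC oreC_is_monoid_morphism.

Lemma ore_mulE (p q : ore delta) :
  p * q = skew_act (ore_shift delta) (p : {poly R}) (q : {poly R}).
Proof. by []. Qed.

Lemma oreC_mul r (p : ore delta) : oreC r * p = r *: (p : {poly R}).
Proof. exact: skew_actC. Qed.

Lemma oreX_mul (p : ore delta) : oreX * p = ore_shift delta p.
Proof. by rewrite ore_mulE /oreX -['X]expr1 skew_actXn. Qed.

Lemma oreX_comm r : oreX * oreC r = oreC (sigma r) * oreX + oreC (delta r).
Proof.
rewrite oreX_mul oreC_mul /ore_shift /oreC !map_polyC /= ?mul_polyC //.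
Qed.

Lemma oreXn n : oreX ^+ n = ('X^n : {poly R}).
Proof. by elim: n => // n IH; rewrite exprS IH oreX_mul ore_shiftXn. Qed.

Lemma ore_sum (p : ore delta) :
  p = \sum_(i < size (p : {poly R})) oreC (p : {poly R})`_i * oreX ^+ i.
Proof.
rewrite -[LHS](coefK (p : {poly R})) poly_def; apply: eq_bigr => i _.
by rewrite oreC_mul oreXn.
Qed.

Let scale (a : k) (p : ore delta) : ore delta := a%:A *: (p : {poly R}).
Fact ore_scalerA a b m : scale a (scale b m) = scale (a * b) m.
Proof. by rewrite /scale scalerA -scalerAl mul1r scalerA. Qed.
Fact ore_scale1r : left_id 1 scale.
Proof. by move=> m; rewrite /scale !scale1r. Qed.
Fact ore_scalerDr : right_distributive scale +%R.
Proof. by move=> a m n; apply: scalerDr. Qed.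
Fact ore_scalerDl m : {morph scale^~ m : a b / a + b}.
Proof. by move=> a b; rewrite /scale !scalerDl. Qed.
HB.instance Definition _ := GRing.Zmodule_isLmodule.Build k (ore delta)
  ore_scalerA ore_scale1r ore_scalerDr ore_scalerDl.

Lemma ore_scaleE a (p : ore delta) : a *: p = oreC a%:A * p.
Proof. by rewrite oreC_mul. Qed.

Fact ore_scalerAl a (p q : ore delta) : a *: (p * q) = (a *: p) * q.
Proof. by rewrite !ore_scaleE mulrA. Qed.
HB.instance Definition _ := GRing.Lmodule_isLalgebra.Build k (ore delta) ore_scalerAl.

Fact ore_scalerAr a (p q : ore delta) : a *: (p * q) = p * (a *: q).
Proof.
have comX : oreC a%:A * oreX = oreX * oreC a%:A.
  by rewrite oreX_comm der_alg rmorph0 addr0 linearZ rmorph1.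
have comC r : oreC a%:A * oreC r = oreC r * oreC a%:A.
  by rewrite -!rmorphM -scalerAl mul1r -scalerAr mulr1.
have com : oreC a%:A * p = p * oreC a%:A.
  rewrite (ore_sum p) mulr_sumr mulr_suml; apply: eq_bigr => i _.
  by rewrite mulrA comC -!mulrA; congr (_ * _); apply: commrX.
by rewrite !ore_scaleE !mulrA com.
Qed.
HB.instance Definition _ := GRing.Lalgebra_isAlgebra.Build k (ore delta) ore_scalerAr.

End OreRing.
Arguments oreX {k R sigma} delta.
Arguments oreC {k R sigma} delta.

Section PolyMul.
Variable k : fieldType.
Definition lmul (b c : {poly k}) : {poly k} := b * c.
Definition rmul (c b : {poly k}) : {poly k} := b * c.
Fact lmul_is_linear b : linear (lmul b).
Proof. by move=> a p q; rewrite /lmul mulrDr scalerAr. Qed.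
Fact rmul_is_linear c : linear (rmul c).
Proof. by move=> a p q; rewrite /rmul mulrDl scalerAl. Qed.
HB.instance Definition _ b := GRing.isLinear.Build k {poly k} {poly k} _
  (lmul b) (lmul_is_linear b).
HB.instance Definition _ c := GRing.isLinear.Build k {poly k} {poly k} _
  (rmul c) (rmul_is_linear c).

Lemma poly_linear_ext (U : lmodType k) (f g : {poly k} -> U) :
  linear f -> linear g -> (forall n, f 'X^n = g 'X^n) -> f =1 g.
Proof.
move=> lf lg fg p.
pose Lf := GRing.isLinear.Build k {poly k} U _ f lf.
pose Lg := GRing.isLinear.Build k {poly k} U _ g lg.
pose F : {linear {poly k} -> U} := HB.pack f Lf.
pose G : {linear {poly k} -> U} := HB.pack g Lg.
rewrite -[p]coefK poly_def -[f]/(F : _ -> _) -[g]/(G : _ -> _) !linear_sum.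
by apply: eq_bigr => i _; rewrite !linearZ /= fg.
Qed.
End PolyMul.

Section Twisting.
Variables (k : fieldType) (V : lmodType k) (s t : {linear V -> V}).
Local Notation B := {poly k}.

(* z (x) b |-> s(z) (x) x b + t(z) (x) b *)
Definition xstep : tprod V B -> tprod V B :=
  tensor_map s (lmul 'X) \+ tensor_map t idfun.
HB.instance Definition _ := GRing.Linear.on xstep.

Lemma xstepE z b : xstep (tensor z b) = tensor (s z) ('X * b) + tensor (t z) b.
Proof. by rewrite /xstep /= !tensor_mapE. Qed.

Lemma iter_xstep_linear n : linear (iter n xstep).
Proof.
elim: n => [|n IH] c a b //.
have -> : iter n.+1 xstep (c *: a + b) = xstep (c *: iter n xstep a + iter n xstep b).
  by rewrite iterS IH.
by rewrite linearP.
Qed.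

Let taub (b : B) (z : V) : tprod V B :=
  \sum_(n < size b) b`_n *: iter n xstep (tensor z 1).

Let taub_wide n (b : B) z : (size b <= n)%N ->
  taub b z = \sum_(i < n) b`_i *: iter i xstep (tensor z 1).
Proof.
move=> le_n.
rewrite /taub (big_ord_widen n (fun i => b`_i *: iter i xstep (tensor z 1))) //.
rewrite big_mkcond; apply: eq_bigr => i _; case: ltnP => // le_i.
by rewrite nth_default // scale0r.
Qed.

Fact tau_is_bilinear : bilinear_for *:%R *:%R taub.
Proof.
split=> [z c b b'|b c z z'] /=.
  pose n := maxn (size b) (size b').
  have le_cb : (size (c *: b + b')%R <= n)%N.
    rewrite (leq_trans (size_polyD _ _)) // geq_max leq_maxr andbT.
    by rewrite (leq_trans (size_scale_leq _ _)) // leq_maxl.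
  rewrite (taub_wide _ le_cb) (@taub_wide n b) ?leq_maxl //.
  rewrite (@taub_wide n b') ?leq_maxr // scaler_sumr -big_split.
  by apply: eq_bigr => i _; rewrite coefD coefZ scalerDl scalerA.
rewrite /taub scaler_sumr -big_split; apply: eq_bigr => i _ /=.
rewrite (linearPl (@tensor k V B)) iter_xstep_linear scalerDr !scalerA.
by rewrite [c * _]mulrC.
Qed.
HB.instance Definition _ := bilinear_isBilinear.Build k B V (tprod V B)
  *:%R *:%R taub tau_is_bilinear.

(* The twisting map tau : B (x) V -> V (x) B with tau(x (x) z) =              *)
(* s(z) (x) x + t(z) (x) 1, extended to powers of x; see [tau1], [tauX] and   *)
(* [tau_mul] below.                                                           *)
Definition tau : tprod B V -> tprod V B := tlift taub.
HB.instance Definition _ := GRing.Linear.on tau.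

Let taumb (b : B) (z : V) (c : B) : tprod V B :=
  tensor_map idfun (rmul c) (tau (tensor b z)).
Fact tau_m_is_bilinear b : bilinear_for *:%R *:%R (taumb b).
Proof.
split=> [c a z z'|z a c c']; rewrite /taumb.
  by rewrite linearPr !linearP.
have [u ->] := tprod_sum (tau (tensor b z)).
rewrite !linear_sum /= scaler_sumr -big_split; apply: eq_bigr => i _ /=.
by rewrite !tensor_mapE /= /rmul mulrDr -scalerAr linearPr.
Qed.
HB.instance Definition _ b := bilinear_isBilinear.Build k V B (tprod V B)
  *:%R *:%R (taumb b) (tau_m_is_bilinear b).

(* y |-> (1 (x) m_B) (tau (x) 1) (b (x) y) *)
Definition tau_m (b : B) : tprod V B -> tprod V B := tlift (taumb b).
HB.instance Definition _ b := GRing.Linear.on (tau_m b).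

Lemma tau_mE b z c :
  tau_m b (tensor z c) = tensor_map idfun (rmul c) (tau (tensor b z)).
Proof. exact: tliftE. Qed.

Lemma tau_m_linearl y : linear (tau_m^~ y).
Proof.
move=> a b b'; have [u ->] := tprod_sum y.
have sumE c : tau_m c (\sum_(x <- u) tensor x.1 x.2) =
  \sum_(x <- u) tau_m c (tensor x.1 x.2) by rewrite linear_sum.
rewrite !sumE scaler_sumr -big_split; apply: eq_bigr => i _ /=.
by rewrite !tau_mE (linearPl (@tensor k B V)) !linearP.
Qed.

Lemma tauXn n z : tau (tensor 'X^n z) = iter n xstep (tensor z 1).
Proof.
have -> : tau (tensor 'X^n z) = taub 'X^n z by exact: tliftE.
rewrite (@taub_wide n.+1) ?size_polyXn // big_ord_recr /=.
rewrite big1 => [|i _]; last by rewrite coefXn ltn_eqF // scale0r.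
by rewrite add0r coefXn eqxx scale1r.
Qed.

Lemma tau1 z : tau (tensor 1 z) = tensor z 1.
Proof. exact: (tauXn 0). Qed.

Lemma tauX z : tau (tensor 'X z) = tensor (s z) 'X + tensor (t z) 1.
Proof. by rewrite -['X]expr1 (tauXn 1) /= xstepE mulr1. Qed.

Lemma tau_mXn n y : tau_m 'X^n y = iter n xstep y.
Proof.
have [u ->] := tprod_sum y; rewrite linear_sum /=.
elim: n => [|n IH].
  by apply: eq_bigr => i _; rewrite tau_mE (tauXn 0) tensor_mapE /= /rmul mul1r.
rewrite iterS -IH (linear_sum xstep); apply: eq_bigr => i _ /=.
rewrite !tau_mE !tauXn iterS; move: (iter n _ _) => w.
have := @tlift_uniq k V B _ (tensor_map idfun (rmul i.2) \o xstep)
  (xstep \o tensor_map idfun (rmul i.2)).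
apply=> v b /=.
by rewrite xstepE linearD /= !tensor_mapE xstepE /= /rmul mulrA.
Qed.

(* tau (m_B (x) 1) = (1 (x) m_B) (tau (x) 1) (1 (x) tau) *)
Lemma tau_mul b b' z : tau (tensor (b * b') z) = tau_m b (tau (tensor b' z)).
Proof.
move: b; apply: poly_linear_ext => [a p q|a p q|n].
- by rewrite mulrDl -scalerAl (linearPl (@tensor k B V)) linearP.
- exact: tau_m_linearl.
move: b'; apply: poly_linear_ext => [a p q|a p q|m].
- by rewrite mulrDr -scalerAr (linearPl (@tensor k B V)) linearP.
- by rewrite (linearPl (@tensor k B V)) !linearP.
by rewrite -exprD !tauXn tau_mXn iterD.
Qed.
End Twisting.

Section TwistedModule.
Variables (k : fieldType) (R : algType k) (sigma : {lrmorphism R -> R}).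
Variables (delta : skew_derivation sigma) (P : lmodType R).
Local Notation V := (vspace_of R P).
Local Notation B := {poly k}.

Definition rho (r : R) : V -> V := fun z => r *: (z : P).
Fact rho_is_linear r : linear (rho r).
Proof.
move=> a x y; rewrite /rho !restrictZ /= [LHS]scalerDr !scalerA.
by rewrite -scalerAl mul1r -scalerAr mulr1.
Qed.
HB.instance Definition _ r := GRing.isLinear.Build k V V _ (rho r) (rho_is_linear r).

Variable sg : {linear P -> restrict sigma P}.

(* An R-linear map P -> P^sigma, seen as a k-linear map P -> P *)
Definition kmap : V -> V := sg.
Fact kmap_is_linear : linear kmap.
Proof.
have sigma_alg a : sigma a%:A = a%:A by rewrite linearZ /= rmorph1.
move=> a x y; apply: etrans (linearP sg _ _ _) _; congr (_ + _).
by apply: (congr1 (fun r : R => r *: (sg x : P))); apply: sigma_alg.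
Qed.
HB.instance Definition _ := GRing.isLinear.Build k V V _ kmap kmap_is_linear.

Record skew_map := SkewMap {
  smap :> {linear V -> V};
  smapM : forall (r : R) (z : P),
    smap (r *: z : P) = sigma r *: (smap z : P) + delta r *: z :> P
}.

Variable dl : skew_map.

Let T := xstep kmap dl.

(* The R-module P (x) k[x] *)
Definition ltensor : Type := tprod V B.
HB.instance Definition _ := GRing.Zmodule.on ltensor.
Let lscale (r : R) (y : ltensor) : ltensor := tensor_map (rho r) (@idfun B) y.
Fact ltensor_scalerA a b m : lscale a (lscale b m) = lscale (a * b) m.
Proof.
have := @tlift_uniq k V B _ (tensor_map (rho a) (@idfun B) \o tensor_map (rho b) (@idfun B))
  (tensor_map (rho (a * b)) (@idfun B)).
by apply=> v c /=; rewrite !tensor_mapE /= /rho scalerA.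
Qed.
Fact ltensor_scale1r : left_id 1 lscale.
Proof.
have := @tlift_uniq k V B _ (tensor_map (rho 1) (@idfun B)) idfun.
by apply=> v c /=; rewrite !tensor_mapE /= /rho scale1r.
Qed.
Fact ltensor_scalerDr : right_distributive lscale +%R.
Proof. by move=> a m n; rewrite /lscale raddfD. Qed.
Fact ltensor_scalerDl m : {morph lscale^~ m : a b / a + b}.
Proof.
move=> a b.
have := @tlift_uniq k V B _ (tensor_map (rho (a + b)) (@idfun B))
  (tensor_map (rho a) (@idfun B) \+ tensor_map (rho b) (@idfun B)).
apply=> v c /=; rewrite !tensor_mapE /= /rho scalerDl.
exact: (linearDl (@tensor k V B)).
Qed.
HB.instance Definition _ := GRing.Zmodule_isLmodule.Build R ltensor
  ltensor_scalerA ltensor_scale1r ltensor_scalerDr ltensor_scalerDl.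

Let T' : ltensor -> ltensor := T.
Fact lT_is_zmod_morphism : zmod_morphism T'.
Proof. exact: (raddfB T). Qed.
HB.instance Definition _ := GRing.isZmodMorphism.Build ltensor ltensor T' lT_is_zmod_morphism.

Fact lTZ r (y : ltensor) : T' (r *: y) = sigma r *: T' y + delta r *: y.
Proof.
have := @tlift_uniq k V B _ (T \o tensor_map (rho r) (@idfun B))
  (tensor_map (rho (sigma r)) (@idfun B) \o T \+ tensor_map (rho (delta r)) (@idfun B)).
apply=> v c /=; rewrite /T xstepE !linearD /= !tensor_mapE /= xstepE.
have E1 : kmap (rho r v) = rho (sigma r) (kmap v) by apply: (linearZZ sg r v).
have E2 : dl (rho r v) = rho (sigma r) (dl v) + rho (delta r) v by apply: smapM.
rewrite -addrA; apply: (congr2 +%R); first exact: (congr1 (@tensor k V B ^~ _) E1).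
apply: etrans (congr1 (@tensor k V B ^~ c) E2) _.
exact: (linearDl (@tensor k V B)).
Qed.

(* (r (x) b) (x) y |-> (rho (x) m_B) (1 (x) tau_{B,i} (x) 1) (r (x) b (x) y) *)
Definition tp_act (r : R) (b : B) (y : tprod V B) : tprod V B :=
  tensor_map (rho r) idfun (tau_m kmap dl b y).

(* p in R[x] is read as \sum_n p_n (x) x^n in R (x) k[x] *)
Definition ore_act (p : ore delta) (y : tprod V B) : tprod V B :=
  \sum_(n < size (p : {poly R})) tp_act (p : {poly R})`_n 'X^n y.

Fact ore_actE p y : ore_act p y = skew_act T' p y.
Proof. by apply: eq_bigr => i _; rewrite /tp_act tau_mXn. Qed.

Fact twisted_scalerA a b y : ore_act a (ore_act b y) = ore_act (a * b) y.
Proof. by rewrite !ore_actE; apply: esym; apply: (skew_act_mul lTZ). Qed.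
Fact twisted_scale1r : left_id 1 ore_act.
Proof. by move=> y; rewrite ore_actE skew_actC scale1r. Qed.
Fact twisted_scalerDr : right_distributive ore_act +%R.
Proof. by move=> a y z; rewrite !ore_actE; apply: (@skew_actDr _ _ _ T' a y z). Qed.
Fact twisted_scalerDl y : {morph ore_act^~ y : a b / a + b}.
Proof. by move=> a b; rewrite !ore_actE; apply: (@skew_actD _ _ _ T' a b y). Qed.

End TwistedModule.

(* P (x) k[x] as a module over R[x; sigma, delta] = R (x)_tau k[x], which     *)
(* acts by (rho (x) m_B) (1 (x) tau_{B,i} (x) 1).                             *)
Definition twisted (k : fieldType) (R : algType k) (sigma : {lrmorphism R -> R})
    (delta : skew_derivation sigma) (P : lmodType R)
    (sg : {linear P -> restrict sigma P}) (dl : skew_map delta P) : Type :=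
  tprod (vspace_of R P) {poly k}.

Section TwistedModuleInstance.
Variables (k : fieldType) (R : algType k) (sigma : {lrmorphism R -> R}).
Variables (delta : skew_derivation sigma) (P : lmodType R).
Variables (sg : {linear P -> restrict sigma P}) (dl : skew_map delta P).
Local Notation V := (vspace_of R P).
Local Notation B := {poly k}.

HB.instance Definition _ := GRing.Zmodule.on (twisted sg dl).
HB.instance Definition _ := GRing.Zmodule_isLmodule.Build (ore delta) (twisted sg dl)
  (twisted_scalerA sg dl) (twisted_scale1r sg dl) (twisted_scalerDr sg dl)
  (twisted_scalerDl sg dl).

Lemma oreX_tensor (z : V) (b : B) :
  oreX delta *: (tensor z b : twisted sg dl) =
  tensor (sg z : V) ('X * b) + tensor (smap dl z) b :> tprod V B.
Proof.
apply: etrans (ore_actE _ _ _ _) _; rewrite /oreX -['X]expr1 skew_actXn.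
exact: xstepE.
Qed.

Lemma oreC_tensor (r : R) (z : V) (b : B) :
  oreC delta r *: (tensor z b : twisted sg dl) = tensor (rho r z) b :> tprod V B.
Proof.
apply: etrans (ore_actE _ _ _ _) _; rewrite skew_actC.
exact: tensor_mapE.
Qed.
End TwistedModuleInstance.

(* Total complex of a double complex Y with maps dh : Y_(i+1,j) -> Y_(i,j)    *)
(* and dv : Y_(i,j+1) -> Y_(i,j), signs included in dv.                       *)

Definition antidiagonal (n : nat) : Type := {p : nat * nat | p.1 + p.2 == n}%N.

Section Total.
Variables (S : nzRingType) (Y : nat -> nat -> lmodType S).

(* \bigoplus_(i + j = n) Y_(i,j): the index set is finite, so families over   *)
(* it need no support condition.                                              *)
Definition total (n : nat) : Type :=
  forall p : antidiagonal n, Y (val p).1 (val p).2.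

Section Module.
Variable n : nat.
HB.instance Definition _ := gen_eqMixin (total n).
HB.instance Definition _ := gen_choiceMixin (total n).

Let tadd (y z : total n) : total n := fun p => y p + z p.
Let tzero : total n := fun p => 0.
Let topp (y : total n) : total n := fun p => - y p.
Let tscale (a : S) (y : total n) : total n := fun p => a *: y p.

Fact total_addA : associative tadd.
Proof. by move=> x y z; apply: functional_extensionality_dep => p; apply: addrA. Qed.
Fact total_addC : commutative tadd.
Proof. by move=> x y; apply: functional_extensionality_dep => p; apply: addrC. Qed.
Fact total_add0 : left_id tzero tadd.
Proof. by move=> x; apply: functional_extensionality_dep => p; apply: add0r. Qed.
Fact total_addN : left_inverse tzero topp tadd.
Proof. by move=> x; apply: functional_extensionality_dep => p; apply: addNr. Qed.
HB.instance Definition _ :=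
  GRing.isZmodule.Build (total n) total_addA total_addC total_add0 total_addN.

Fact total_scalerA a b y : tscale a (tscale b y) = tscale (a * b) y.
Proof. by apply: functional_extensionality_dep => p; apply: scalerA. Qed.
Fact total_scale1r : left_id 1 tscale.
Proof. by move=> y; apply: functional_extensionality_dep => p; apply: scale1r. Qed.
Fact total_scalerDr : right_distributive tscale +%R.
Proof. by move=> a y z; apply: functional_extensionality_dep => p; apply: scalerDr. Qed.
Fact total_scalerDl y : {morph tscale^~ y : a b / a + b}.
Proof. by move=> a b; apply: functional_extensionality_dep => p; apply: scalerDl. Qed.
HB.instance Definition _ := GRing.Zmodule_isLmodule.Build S (total n)
  total_scalerA total_scale1r total_scalerDr total_scalerDl.
End Module.

Variables (dh : forall i j, Y i.+1 j -> Y i j) (dv : forall i j, Y i j.+1 -> Y i j).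

Definition up_l n (p : antidiagonal n) : antidiagonal n.+1 :=
  exist _ ((val p).1.+1, (val p).2) (valP p).

Fact up_r_subproof n (p : antidiagonal n) : ((val p).1 + (val p).2.+1 == n.+1)%N.
Proof. by rewrite addnS; exact: (valP p). Qed.
Definition up_r n (p : antidiagonal n) : antidiagonal n.+1 :=
  exist _ ((val p).1, (val p).2.+1) (up_r_subproof p).

Definition total_d n (y : total n.+1) : total n :=
  fun p => dh (y (up_l p)) + dv (y (up_r p)).

Definition corner : antidiagonal 0 := exist _ (0, 0)%N (eqxx _).
Definition total_aug (M : lmodType S) (e : Y 0 0 -> M) (y : total 0) : M :=
  e (y corner).
End Total.

Section KoszulAugmentation.
Variable k : fieldType.

Definition koszul_eps (b : {poly k}) : k^o := b.[0].
Fact koszul_eps_is_linear : linear koszul_eps.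
Proof. by move=> a p q; rewrite /koszul_eps !hornerE. Qed.
HB.instance Definition _ := GRing.isLinear.Build k {poly k} k^o _
  koszul_eps koszul_eps_is_linear.

Variable V : lmodType k.
Let flip_scale (v : V) (a : k^o) : V := a *: v.
Fact flip_scale_is_bilinear : bilinear_for *:%R *:%R flip_scale.
Proof.
split=> [a c v w|v c a b]; rewrite /flip_scale.
  rewrite /= scalerDr; congr (_ + _); rewrite !scalerA.
  by congr (_ *: _); apply: mulrC.
by rewrite scalerDl -scalerA.
Qed.
HB.instance Definition _ := bilinear_isBilinear.Build k V k^o V *:%R *:%R
  flip_scale flip_scale_is_bilinear.

(* The isomorphism V (x) k -> V *)
Definition tensor_unit : tprod V k^o -> V := tlift flip_scale.
HB.instance Definition _ := GRing.Linear.on tensor_unit.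

Lemma tensor_unitE v a : tensor_unit (tensor v a) = a *: v.
Proof. exact: tliftE. Qed.
End KoszulAugmentation.

(* The twisted product of P_. with the Koszul resolution                      *)
(* 0 -> k[x] -> k[x] -> k -> 0 of k over k[x]                                 *)

Section TwistedProduct.
Variables (k : fieldType) (R : algType k) (sigma : {lrmorphism R -> R}).
Variables (delta : skew_derivation sigma).
Variables (P : nat -> lmodType R) (d : forall i, {linear P i.+1 -> P i}).
Variable sg : forall i, {linear P i -> restrict sigma (P i)}.
Variable dl : forall i, skew_map delta (P i).

Definition Yij (i j : nat) : lmodType (ore delta) :=
  match j with
  | 0 | 1 => twisted (sg i) (dl i)
  | _ => 'rV[ore delta]_0
  end.

(* d_i (x) 1 *)
Definition Yh (i j : nat) : Yij i.+1 j -> Yij i j :=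
  match j with
  | 0 | 1 => tensor_map (vspace_map (d i)) (@idfun {poly k})
  | _ => fun=> 0
  end.

(* (-1)^i 1 (x) (x .) *)
Definition Yv (i j : nat) : Yij i j.+1 -> Yij i j :=
  match j with
  | 0 => fun y => ((-1) ^+ i : k) *: tensor_map (@idfun (vspace_of R (P i))) (lmul 'X) y
  | _ => fun=> 0
  end.

Definition Y (n : nat) : lmodType (ore delta) := total Yij n.
Definition Yd (n : nat) : Y n.+1 -> Y n := @total_d _ Yij Yh Yv n.

Variable M : lmodType (ore delta).
Variable mu : {linear P 0%N -> restrict (oreC delta) M}.

(* mu (x) epsilon, followed by M (x) k = M *)
Definition Yaug : Y 0 -> M := @total_aug _ Yij M (fun y =>
  tensor_unit (tensor_map (vspace_map mu) (@koszul_eps k) y)).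
End TwistedProduct.

(* Main.v *)
(* Every element of P (x) k[x] is uniquely p (x) 1 + x t, where x acts on     *)
(* the right factor.  The total complex is the mapping cone of x, so a cycle  *)
(* (a, b) satisfies d a + e x b = 0 with e = (-1)^n; reading off the constant *)
(* coefficient and the shifted part gives d a_0 = 0 and b = - e d (a / x),    *)
(* and (a, b) is the boundary of (c (x) 1, - e a / x), where d c = a_0.       *)
(* Projectivity: as sigma_i is bijective, P_i (x) k[x] is the module induced  *)
(* from the R-module P_i: an R-linear map out of P_i (x) 1 extends uniquely,  *)
(* the value at sigma_i(z) (x) x^(n+1) being forced by the identity           *)
(* sigma_i(z) (x) x^(n+1) = x (z (x) x^n) - delta_i(z) (x) x^n.               *)

From Pilot Require Import Defs.
From HB Require Import structures.
From mathcomp Require Import all_boot all_order all_algebra.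
From mathcomp Require Import boolp.
Set Implicit Arguments.
Unset Strict Implicit.
Unset Printing Implicit Defensive.
Import GRing.Theory.
Local Open Scope ring_scope.

(** Up to signs, Y is the mapping cone of multiplication by x on the right factor of P ⊗ k[x]. That
    map is injective with cokernel P, so the cone has the homology of P, which is M in degree 0.
    [tprod_aug_exact] and [tprod_cone_exact] make this explicit by splitting each element into its
    constant coefficient and a multiple of x ([tprod_decomp]).

    Projectivity uses that σ_i is bijective: z ⊗ x^(n+1) can then be expressed through x and lower
    powers, so P_i ⊗ k[x] is the module induced from P_i. Its maps over the Ore extension are the
    R-linear maps on P_i ([twisted_ext], [twisted_extension]), and induction preserves projectives
    ([twisted_projective]).

    The differentials and the augmentation are linear over the Ore extension because σ and δ are
    chain maps and δ_0 lifts the action of x on M; [twisted_linear] reduces this to generators. *)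

Lemma tprod_additive_ext (k : fieldType) (V W : lmodType k) (U : zmodType)
    (f g : tprod V W -> U) : zmod_morphism f -> zmod_morphism g ->
  (forall v w, f (tensor v w) = g (tensor v w)) -> f =1 g.
Proof.
move=> fB gB fg t.
pose F : {additive tprod V W -> U} := HB.pack f (GRing.isZmodMorphism.Build _ _ f fB).
pose G : {additive tprod V W -> U} := HB.pack g (GRing.isZmodMorphism.Build _ _ g gB).
rewrite -[f]/(F : _ -> _) -[g]/(G : _ -> _).
by have [s ->] := tprod_sum t; rewrite !raddf_sum; apply: eq_bigr => x _; apply: fg.
Qed.

(** Coefficients move to the left factor, v ⊗ c x^n = c v ⊗ x^n, so additivity is enough. The target
    can thus be a module over the Ore extension, with no k-structure chosen on it. *)
Lemma tprod_poly_ext (k : fieldType) (V : lmodType k) (U : zmodType)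
    (f g : tprod V {poly k} -> U) : zmod_morphism f -> zmod_morphism g ->
  (forall v n, f (tensor v 'X^n) = g (tensor v 'X^n)) -> f =1 g.
Proof.
move=> fB gB fg; apply: tprod_additive_ext => // v b.
pose F : {additive tprod V {poly k} -> U} :=
  HB.pack f (GRing.isZmodMorphism.Build _ _ f fB).
pose G : {additive tprod V {poly k} -> U} :=
  HB.pack g (GRing.isZmodMorphism.Build _ _ g gB).
rewrite -[f]/(F : _ -> _) -[g]/(G : _ -> _).
rewrite -[b]coefK poly_def linear_sumr !raddf_sum; apply: eq_bigr => i _ /=.
rewrite linearZr_LR -(linearZl_LR (@tensor k V {poly k})).
exact: fg.
Qed.

(** * Exactness of the cone of x on P ⊗ k[x] *)

Section TwistedProductExactness.
Variable k : fieldType.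
Local Notation B := {poly k}.
Local Notation X := (lmul ('X : B)).

Definition const_coef (V : lmodType k) : tprod V B -> V :=
  @tensor_unit k V \o tensor_map idfun (@koszul_eps k).
HB.instance Definition _ V := GRing.Linear.on (@const_coef V).

(** Division by x after discarding the constant coefficient. *)
Definition poly_shift (V : lmodType k) : tprod V B -> tprod V B :=
  tensor_map idfun (drop_poly 1).
HB.instance Definition _ V := GRing.Linear.on (@poly_shift V).

Lemma const_coefE (V : lmodType k) (v : V) (b : B) : const_coef (tensor v b) = b.[0] *: v.
Proof. by rewrite /const_coef /= tensor_mapE tensor_unitE. Qed.

Lemma tprod_decomp (V : lmodType k) (t : tprod V B) :
  t = tensor (const_coef t) 1 + tensor_map idfun X (poly_shift t).
Proof.
pose f := fun t : tprod V B =>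
  tensor (const_coef t) 1 + tensor_map idfun X (poly_shift t).
apply: (tprod_additive_ext (g := f)) => // [a b|v b].
  rewrite /f !linearB /= opprD addrACA; congr (_ + _).
  exact: (linearBl (@tensor k V B)).
rewrite /f const_coefE /poly_shift tensor_mapE /= tensor_mapE /=.
rewrite (linearZl_LR (@tensor k V B)) /= -linearZr_LR -linearDr; congr (tensor v _).
apply/polyP=> i; rewrite !(coefD, coefZ, coef1, coefXM, coef_drop_poly) /lmul.
rewrite horner_coef0.
by case: i => [|i]; rewrite ?mulr1 ?addr0 ?mulr0 ?add0r // addn1.
Qed.

Lemma poly_shiftX (V : lmodType k) (t : tprod V B) :
  poly_shift (tensor_map idfun X t) = t.
Proof.
apply: (tprod_additive_ext (f := @poly_shift V \o tensor_map idfun X) (g := id)) => //.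
  exact: raddfB.
move=> v b /=; rewrite /poly_shift !tensor_mapE /=; congr (tensor v _).
by apply/polyP=> i; rewrite coef_drop_poly addn1 coefXM.
Qed.

Lemma const_coefX (V : lmodType k) (t : tprod V B) :
  const_coef (tensor_map idfun X t) = 0.
Proof.
apply: (tprod_additive_ext (f := @const_coef V \o tensor_map idfun X) (g := fun=> 0)).
- exact: raddfB.
- by move=> ? ?; rewrite subr0.
by move=> v b /=; rewrite tensor_mapE const_coefE /= /lmul hornerM hornerX mul0r scale0r.
Qed.

Section Maps.
Variables (V W : lmodType k) (f : {linear V -> W}).

Lemma poly_shift_map t :
  poly_shift (tensor_map f idfun t) = tensor_map f idfun (poly_shift t).
Proof.
apply: (tlift_uniq (g := @poly_shift W \o tensor_map f idfun)
  (h := tensor_map f idfun \o @poly_shift V)) => v b /=.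
by rewrite /poly_shift !tensor_mapE.
Qed.

Lemma const_coef_map t : const_coef (tensor_map f idfun t) = f (const_coef t).
Proof.
apply: (tlift_uniq (g := @const_coef W \o tensor_map f idfun)
  (h := f \o @const_coef V)) => v b /=.
by rewrite tensor_mapE !const_coefE linearZ.
Qed.

Lemma tensor_unit_map t :
  tensor_unit (tensor_map f (@koszul_eps k) t) = f (const_coef t).
Proof.
apply: (tlift_uniq (g := @tensor_unit k W \o tensor_map f (@koszul_eps k))
  (h := f \o @const_coef V)) => v b /=.
by rewrite tensor_mapE const_coefE linearZ tensor_unitE.
Qed.

Lemma tensor_mapX t : tensor_map f idfun (tensor_map idfun X t) =
  tensor_map idfun X (tensor_map f idfun t).
Proof.
apply: (tlift_uniq (g := tensor_map f (@idfun B) \o tensor_map idfun X)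
  (h := tensor_map idfun X \o tensor_map f idfun)) => v b /=.
by rewrite !tensor_mapE.
Qed.
End Maps.

Lemma tensor_map_comp0 (V W U : lmodType k) (f : {linear V -> W})
  (g : {linear W -> U}) : (forall v, g (f v) = 0) ->
  forall t, tensor_map g (@idfun B) (tensor_map f idfun t) = 0.
Proof.
move=> gf t.
apply: (tlift_uniq (g := tensor_map g (@idfun B) \o tensor_map f idfun) (h := \0))
  => v b /=.
by rewrite !tensor_mapE gf (linear0l (@tensor k U B)).
Qed.

Section Exact.
Variables (V2 V1 V0 : lmodType k) (f : {linear V2 -> V1}) (g : {linear V1 -> V0}).
Hypothesis ker_im : forall z, g z = 0 -> exists w, f w = z.

(** The constant coefficient of [a] is a boundary [f c], and what remains of [a] is a multiple of
    x. *)
Lemma tprod_aug_exact a : g (const_coef a) = 0 ->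
  exists a' b', tensor_map f idfun a' + tensor_map idfun X b' = a.
Proof.
move=> /ker_im [c fc]; exists (tensor c 1), (poly_shift a).
by rewrite tensor_mapE /= fc -tprod_decomp.
Qed.

Lemma tprod_cone_exact n a b :
    tensor_map g idfun a + ((-1) ^+ n : k) *: tensor_map idfun X b = 0 ->
  exists a' b', tensor_map f idfun a' + ((-1) ^+ n.+1 : k) *: tensor_map idfun X b' = a
    /\ tensor_map g idfun b' = b.
Proof.
move=> ab0.
have /ker_im [c fc] : g (const_coef a) = 0.
  have := congr1 (@const_coef V0) ab0.
  by rewrite linearD linearZ /= const_coef_map const_coefX scaler0 addr0 linear0.
(* The sign squares to 1 in the first equation and cancels the sign of [ab0] in the second. *)
exists (tensor c 1), ((-1) ^+ n.+1 *: poly_shift a); split.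
  by rewrite tensor_mapE /= fc linearZ scalerA -expr2 sqrr_sign scale1r -tprod_decomp.
have := congr1 (@poly_shift V0) ab0.
rewrite linearD linearZ /= poly_shift_map poly_shiftX linear0 => /eqP.
rewrite addr_eq0 => /eqP E; rewrite linearZ /= E.
by rewrite scalerN -scaleNr exprS mulN1r opprK scalerA -expr2 sqrr_sign scale1r.
Qed.
End Exact.
End TwistedProductExactness.

(** * Families on an antidiagonal, given by columns 0 and 1 *)

Section Antidiagonal.
Variables (n : nat) (F : nat -> nat -> Type).
Variables (a : F n.+1 0) (b : F n 1) (c : forall i j, F i j.+2).

Definition antidiag0 : antidiagonal n.+1 := exist _ (n.+1, 0)%N (introT eqP (addn0 n.+1)).
Definition antidiag1 : antidiagonal n.+1 := exist _ (n, 1)%N (introT eqP (addn1 n)).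

Variant antidiagonal_spec : antidiagonal n.+1 -> Prop :=
  | Antidiagonal0 : antidiagonal_spec antidiag0
  | Antidiagonal1 : antidiagonal_spec antidiag1
  | Antidiagonal2 i j h : antidiagonal_spec (exist _ (i, j.+2) h).

Lemma antidiagonalP p : antidiagonal_spec p.
Proof.
case: p => -[i [|[|j]]] /= h; last by constructor.
- have E : i = n.+1 by rewrite -(eqP h) addn0.
  by subst i; rewrite (bool_irrelevance h (introT eqP (addn0 n.+1))); constructor.
- have E : i = n by apply: succn_inj; rewrite -(eqP h) addn1.
  by subst i; rewrite (bool_irrelevance h (introT eqP (addn1 n))); constructor.
Qed.

(** The row [i] equals [n.+1] or [n] only propositionally, so [a] and [b] are transported; at
    [antidiag0] and [antidiag1] the transport is along a loop in [nat], hence trivial. *)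
Definition antidiagonal_case (p : antidiagonal n.+1) : F (val p).1 (val p).2 :=
  match p with
  | exist (i, j) h =>
    match j return (i + j == n.+1)%N -> F i j with
    | 0 => fun h => ecast i (F i 0) (esym (etrans (esym (addn0 i)) (eqP h))) a
    | 1 => fun h => ecast i (F i 1)
        (esym (succn_inj (etrans (esym (addn1 i)) (eqP h)))) b
    | j'.+2 => fun=> c i j'
    end h
  end.

Lemma antidiagonal_case0 : antidiagonal_case antidiag0 = a.
Proof. by rewrite /antidiagonal_case /=; rewrite eq_axiomK. Qed.

Lemma antidiagonal_case1 : antidiagonal_case antidiag1 = b.
Proof. by rewrite /antidiagonal_case /=; rewrite eq_axiomK. Qed.
End Antidiagonal.

(** Q is a retract of Q0 ⊕ Q1, so lifts of [h \o i0] and [h \o i1] add up to a lift of [h]. *)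
Lemma projective_split (S : nzRingType) (Q Q0 Q1 : lmodType S)
    (i0 : {linear Q0 -> Q}) (i1 : {linear Q1 -> Q})
    (p0 : {linear Q -> Q0}) (p1 : {linear Q -> Q1}) :
  (forall q, q = i0 (p0 q) + i1 (p1 q)) ->
  projective Q0 -> projective Q1 -> projective Q.
Proof.
move=> dec proj0 proj1 N N' g h g_surj.
have [h0 h0P] := proj0 N N' g (h \o i0) g_surj.
have [h1 h1P] := proj1 N N' g (h \o i1) g_surj.
exists ((h0 \o p0) \+ (h1 \o p1)) => q /=.
by rewrite linearD h0P h1P /= -linearD -dec.
Qed.

(** * Linearity over the Ore extension and maps out of V ⊗ k[x] *)

Section OreLinear.
Variables (k : fieldType) (R : algType k) (sigma : {lrmorphism R -> R}).
Variables (delta : skew_derivation sigma) (N N' : lmodType (ore delta)).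

Lemma ore_linear (f : N -> N') : zmod_morphism f ->
  (forall r y, f (oreC delta r *: y) = oreC delta r *: f y) ->
  (forall y, f (oreX delta *: y) = oreX delta *: f y) -> linear f.
Proof.
move=> fB fC fX.
pose F : {additive N -> N'} := HB.pack f (GRing.isZmodMorphism.Build _ _ f fB).
have fXn n y : f (oreX delta ^+ n *: y) = oreX delta ^+ n *: f y.
  elim: n y => [|n IH] y; first by rewrite !scale1r.
  by rewrite !exprSr -!scalerA IH fX.
move=> p y z; rewrite -[f]/(F : _ -> _) raddfD /=; congr (_ + _).
rewrite {1}(ore_sum p) scaler_suml -[f]/(F : _ -> _) raddf_sum.
rewrite [in RHS](ore_sum p) scaler_suml.
by apply: eq_bigr => i _; rewrite /= -!scalerA fC fXn.
Qed.
End OreLinear.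

Section PolyLift.
Variables (k : fieldType) (V U : lmodType k) (F : nat -> {linear V -> U}).
Local Notation B := {poly k}.

Let pairing (v : V) (b : B) : U := \sum_(i < size b) b`_i *: F i v.

Let pairing_wide n v (b : B) : (size b <= n)%N ->
  pairing v b = \sum_(i < n) b`_i *: F i v.
Proof.
move=> le_n; rewrite /pairing (big_ord_widen n (fun i => b`_i *: F i v)) //.
rewrite big_mkcond; apply: eq_bigr => i _; case: ltnP => // le_i.
by rewrite nth_default // scale0r.
Qed.

Fact pairing_is_bilinear : bilinear_for *:%R *:%R pairing.
Proof.
split=> [b c v w|v c b b'] /=.
  rewrite /pairing scaler_sumr -big_split; apply: eq_bigr => i _ /=.
  by rewrite linearP scalerDr !scalerA [c * _]mulrC.
pose n := maxn (size (c *: b + b')) (maxn (size b) (size b')).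
rewrite !(@pairing_wide n) /n ?leq_max ?leqnn ?orbT //.
rewrite scaler_sumr -big_split.
by apply: eq_bigr => i _; rewrite coefD coefZ scalerDl scalerA.
Qed.
HB.instance Definition _ := bilinear_isBilinear.Build k V B U
  *:%R *:%R pairing pairing_is_bilinear.

(** The universal property of V ⊗ k[x] as a direct sum of copies of V, one for each power of x. *)
Definition poly_lift : tprod V B -> U := tlift pairing.
HB.instance Definition _ := GRing.Linear.on poly_lift.

Lemma poly_liftXn v n : poly_lift (tensor v 'X^n) = F n v.
Proof.
rewrite /poly_lift tliftE /= (@pairing_wide n.+1) ?size_polyXn // big_ord_recr /=.
rewrite big1 => [|i _]; last by rewrite coefXn ltn_eqF // scale0r.
by rewrite add0r coefXn eqxx scale1r.
Qed.
End PolyLift.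

(** * P ⊗ k[x] as an induced module, and its projectivity *)

Section TwistedProjective.
Variables (k : fieldType) (R : algType k) (sigma : {lrmorphism R -> R}).
Variables (delta : skew_derivation sigma) (P : lmodType R).
Variables (sg : {linear P -> restrict sigma P}) (dl : skew_map delta P).
Local Notation V := (vspace_of R P).
Local Notation Q := (twisted sg dl).
Local Notation gen z n := (tensor (z : V) ('X^n : {poly k}) : Q).

Lemma oreX_gen (z : P) n :
  oreX delta *: gen z n = gen (sg z : P) n.+1 + gen (smap dl z) n.
Proof. by rewrite [LHS]oreX_tensor exprS. Qed.

Lemma oreC_gen (r : R) (z : P) n : oreC delta r *: gen z n = gen (r *: z) n.
Proof. exact: oreC_tensor. Qed.

Lemma twisted_linear (N : lmodType (ore delta)) (f : Q -> N) : zmod_morphism f ->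
    (forall r z n, f (oreC delta r *: gen z n) = oreC delta r *: f (gen z n)) ->
    (forall z n, f (oreX delta *: gen z n) = oreX delta *: f (gen z n)) ->
  linear f.
Proof.
move=> fB fC fX; apply: ore_linear => // [r|].
  apply: (@tprod_poly_ext k V N (fun y => f (oreC delta r *: (y : Q)))
    (fun y => oreC delta r *: f y)) => // a b; first by rewrite -fB -scalerBr.
  by rewrite -scalerBr -fB.
apply: (@tprod_poly_ext k V N (fun y => f (oreX delta *: (y : Q)))
  (fun y => oreX delta *: f y)) => // a b; first by rewrite -fB -scalerBr.
by rewrite -scalerBr -fB.
Qed.

Section Inverse.
Variables (s' : {additive P -> P}) (sgK : cancel sg s') (s'K : cancel s' sg).

(** P ⊗ 1 generates: every v is σ(s' v), so v ⊗ x^(n+1) is reached from lower powers by x. *)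
Lemma twisted_ext (N : lmodType (ore delta)) (f g : {linear Q -> N}) :
  (forall z, f (gen z 0) = g (gen z 0)) -> f =1 g.
Proof.
move=> fg0; apply: (@tprod_poly_ext k V N f g); [exact: (raddfB f)|exact: (raddfB g)|].
move=> v n; elim: n v => [|n IH] v; first exact: fg0.
have E : gen v n.+1 = oreX delta *: gen (s' v) n - gen (smap dl (s' v)) n.
  by rewrite oreX_gen s'K addrK.
by rewrite [tensor _ _]E !linearB !linearZ /= !IH.
Qed.

Section Extension.
Variables (N : lmodType (ore delta)) (u : {linear P -> restrict (oreC delta) N}).

(** The value forced on z ⊗ x^n: the formula for x (s' z ⊗ x^m), solved for its leading term. *)
Fixpoint gen_image n (z : P) : N :=
  if n is m.+1 then oreX delta *: gen_image m (s' z) - gen_image m (smap dl (s' z))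
  else u z.

Hypothesis sigma_bij : bijective sigma.

Lemma gen_image_is_zmod_morphism n : zmod_morphism (gen_image n).
Proof.
elim: n => [|n IH] y z /=; first exact: (raddfB u).
by rewrite !raddfB /= !IH scalerBr opprD addrACA -opprD.
Qed.
HB.instance Definition _ n :=
  GRing.isZmodMorphism.Build P N (gen_image n) (gen_image_is_zmod_morphism n).

(** With r' the preimage of r under [sigma], x r' = r x + δ(r'); the extra δ(r') cancels the one
    produced by [smapM]. *)
Lemma gen_imageZ n r z : gen_image n (r *: z) = oreC delta r *: gen_image n z.
Proof.
have [sigma' sigmaK sigma'K] := sigma_bij.
elim: n r z => [|n IH] r z /=; first exact: (linearZZ u).
(* The inverse of a σ-semilinear map is semilinear for the inverse of σ. *)
have -> : s' (r *: z) = sigma' r *: s' z.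
  apply: (can_inj sgK); rewrite s'K; apply: esym; apply: etrans (linearZZ sg _ _) _.
  by rewrite restrictZ /= sigma'K s'K.
rewrite IH smapM raddfD /= !IH sigma'K scalerA oreX_comm sigma'K scalerDl.
by rewrite scalerBr scalerA opprD addrACA subrr addr0.
Qed.

Let U := vspace_of R (restrict (oreC delta) N).
Let F n : V -> U := gen_image n.
Fact gen_image_is_linear n : linear (F n).
Proof.
move=> c y z; rewrite /F [LHS](raddfD (gen_image n)); congr (_ + _).
exact: gen_imageZ.
Qed.
HB.instance Definition _ n := GRing.isLinear.Build k V U _ (F n) (gen_image_is_linear n).

Let FL n : {linear V -> U} := F n.
Let G : Q -> N := poly_lift FL.
Let GE z n : G (gen z n) = gen_image n z.
Proof. exact: (poly_liftXn FL). Qed.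

Lemma twisted_extension : exists G : {linear Q -> N}, forall z, G (gen z 0) = u z.
Proof.
have GB : zmod_morphism G by exact: (raddfB (poly_lift FL)).
have GD a b : G (a + b) = G a + G b by exact: (raddfD (poly_lift FL)).
have G_lin : linear G.
  apply: twisted_linear => // [r z n|z n]; first by rewrite oreC_gen !GE gen_imageZ.
  by rewrite oreX_gen GD !GE /= sgK subrK.
pose GL : {linear Q -> N} := HB.pack G (GRing.isLinear.Build _ _ _ _ G G_lin).
by exists GL => z; apply: GE.
Qed.
End Extension.

Lemma twisted_projective : bijective sigma -> projective P -> projective Q.
Proof.
move=> sigma_bij P_proj N N' g h g_surj.
pose u : P -> restrict (oreC delta) N' := fun z => h (gen z 0).
have u_lin : linear u.
  move=> r y z; rewrite /u restrictZ -linearZ -linearD; congr (h _).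
  by rewrite oreC_gen; apply: (linearDl (@tensor k V {poly k})).
pose uL : {linear P -> restrict (oreC delta) N'} :=
  HB.pack u (GRing.isLinear.Build _ _ _ _ u u_lin).
pose gR : {linear restrict (oreC delta) N -> restrict (oreC delta) N'} :=
  restrict_map (oreC delta) g.
(* Restriction to R leaves the underlying map unchanged, so [g] stays surjective. *)
have [u' u'P] := P_proj _ _ gR uL g_surj.
have [G GE] := twisted_extension u' sigma_bij.
exists G; apply: (@twisted_ext _ (g \o G) h) => z /=.
by rewrite GE; apply: u'P.
Qed.
End Inverse.
End TwistedProjective.

(** * Linearity of the differentials and the augmentation *)

Section TwistedLinear.
Variables (k : fieldType) (R : algType k) (sigma : {lrmorphism R -> R}).
Variables (delta : skew_derivation sigma).

Lemma tensor_map_ore_linear (P P' : lmodType R)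
    (sg : {linear P -> restrict sigma P}) (dl : skew_map delta P)
    (sg' : {linear P' -> restrict sigma P'}) (dl' : skew_map delta P')
    (f : {linear P -> P'}) :
  (forall z, f (sg z) = sg' (f z)) -> (forall z, f (dl z) = dl' (f z)) ->
  linear (tensor_map (vspace_map f) (@idfun {poly k}) : twisted sg dl -> twisted sg' dl').
Proof.
move=> f_sg f_dl; set F := (X in linear X).
have FB : zmod_morphism F by exact: (raddfB (tensor_map (vspace_map f) idfun)).
have FD a b : F (a + b) = F a + F b by exact: (raddfD (tensor_map (vspace_map f) idfun)).
have FE z b : F (tensor z b) = tensor (f z : vspace_of R P') b by exact: tensor_mapE.
apply: twisted_linear => // [r z n|z n].
  by rewrite oreC_gen !FE oreC_gen linearZ.
by rewrite oreX_gen FD !FE oreX_gen f_sg f_dl.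
Qed.

Section Endo.
Variables (P : lmodType R) (sg : {linear P -> restrict sigma P}) (dl : skew_map delta P).
Local Notation Q := (twisted sg dl).

Lemma tensor_map_lmulX_ore_linear :
  linear (tensor_map idfun (lmul 'X) : Q -> Q).
Proof.
set F := (X in linear X).
have FB : zmod_morphism F by exact: (raddfB (tensor_map idfun (lmul 'X))).
have FD a b : F (a + b) = F a + F b by exact: (raddfD (tensor_map idfun (lmul 'X))).
have FE z b : F (tensor z b) = tensor z ('X * b) by exact: tensor_mapE.
apply: twisted_linear => // [r z n|z n].
  by rewrite oreC_gen !FE -exprS oreC_gen.
by rewrite oreX_gen FD !FE -!exprS oreX_gen.
Qed.

Lemma sign_tensor_map_lmulX_ore_linear n :
  linear (fun y : Q => ((-1) ^+ n : k) *: tensor_map idfun (lmul 'X) y : Q).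
Proof.
(* The sign is a scalar of k; as a conditional negation it makes sense in the module over the Ore
   extension as well. *)
move=> p y z; rewrite -signr_odd !scaler_sign tensor_map_lmulX_ore_linear.
by case: odd; rewrite // opprD scalerN.
Qed.

(** On z ⊗ 1, ε kills σ(z) ⊗ x and leaves μ(δ z) = x μ(z); on higher powers both sides vanish. *)
Lemma tensor_unit_ore_linear (M : lmodType (ore delta))
    (mu : {linear P -> restrict (oreC delta) M})
    (mu_dl : forall z, mu (dl z) = oreX delta *: (mu z : M)) :
  linear (fun y : Q => tensor_unit (tensor_map (vspace_map mu) (@koszul_eps k) y) : M).
Proof.
set F := (X in linear X).
pose FL : {linear tprod (vspace_of R P) {poly k} ->
    vspace_of R (restrict (oreC delta) M)} :=
  @tensor_unit k _ \o tensor_map (vspace_map mu) (@koszul_eps k).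
have FB : zmod_morphism F by exact: (raddfB FL).
have FD a b : F (a + b) = F a + F b by exact: (raddfD FL).
have FE z n : F (tensor z 'X^n) = (if n is 0 then mu z else 0).
  rewrite /F tensor_mapE tensor_unitE /= /koszul_eps hornerXn expr0n.
  by case: n => [|n]; rewrite ?scale1r ?scale0r.
apply: twisted_linear => // [r z n|z n].
  rewrite oreC_gen !FE; case: n => [|n]; rewrite ?scaler0 //.
  exact: (linearZZ mu).
by rewrite oreX_gen FD !FE add0r; case: n => [|n]; rewrite ?scaler0.
Qed.
End Endo.
End TwistedLinear.

(** * Total complex of a double complex with two columns *)

Section TotalComplex.
Variables (S : nzRingType) (Y : nat -> nat -> lmodType S).

(** Needed because [up_l] and [up_r] give points whose membership proofs differ from those of
    [antidiag0] and [antidiag1]. *)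
Lemma total_irr n (y : Defs.total Y n) i j h h' :
  y (exist _ (i, j) h) = y (exist _ (i, j) h').
Proof. by rewrite (bool_irrelevance h h'). Qed.

Definition total_pair n (a : Y n.+1 0) (b : Y n 1) : Defs.total Y n.+1 :=
  antidiagonal_case (F := fun i j => Y i j) a b (fun i j => 0).

Lemma total_pair0 n a b : @total_pair n a b (antidiag0 n) = a.
Proof. exact: antidiagonal_case0. Qed.

Lemma total_pair1 n a b : @total_pair n a b (antidiag1 n) = b.
Proof. exact: antidiagonal_case1. Qed.

Lemma total_pairP n c a a' b b' : @total_pair n (c *: a + a') (c *: b + b') =
  c *: total_pair a b + total_pair a' b'.
Proof.
apply: functional_extensionality_dep => p.
case: (antidiagonalP p) => [||i j h].
- rewrite -[RHS]/(c *: total_pair a b (antidiag0 n) + total_pair a' b' (antidiag0 n)).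
  by rewrite !total_pair0.
- rewrite -[RHS]/(c *: total_pair a b (antidiag1 n) + total_pair a' b' (antidiag1 n)).
  by rewrite !total_pair1.
by rewrite -[RHS]/(c *: (0 : Y i j.+2) + 0) scaler0 addr0.
Qed.

Hypothesis Y_small : forall i j (y : Y i j.+2), y = 0.

Lemma total_pair_eta n (y : Defs.total Y n.+1) :
  y = total_pair (y (antidiag0 n)) (y (antidiag1 n)).
Proof.
apply: functional_extensionality_dep => p.
case: (antidiagonalP p) => [||i j h]; rewrite ?total_pair0 ?total_pair1 //.
exact: Y_small.
Qed.

Lemma totalS_projective n :
  projective (Y n.+1 0) -> projective (Y n 1) -> projective (Defs.total Y n.+1).
Proof.
pose i0 (a : Y n.+1 0) := total_pair a (0 : Y n 1).
pose i1 (b : Y n 1) := total_pair (0 : Y n.+1 0) b.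
pose p0 (y : Defs.total Y n.+1) := y (antidiag0 n).
pose p1 (y : Defs.total Y n.+1) := y (antidiag1 n).
have i0_lin : linear i0 by move=> c a a'; rewrite -total_pairP scaler0 addr0.
have i1_lin : linear i1 by move=> c b b'; rewrite -total_pairP scaler0 addr0.
have p0_lin : linear p0 by [].
have p1_lin : linear p1 by [].
apply: (@projective_split S _ _ _
  (HB.pack_for {linear Y n.+1 0 -> Defs.total Y n.+1}
     i0 (GRing.isLinear.Build _ _ _ _ i0 i0_lin))
  (HB.pack_for {linear Y n 1 -> Defs.total Y n.+1}
     i1 (GRing.isLinear.Build _ _ _ _ i1 i1_lin))
  (HB.pack_for {linear Defs.total Y n.+1 -> Y n.+1 0}
     p0 (GRing.isLinear.Build _ _ _ _ p0 p0_lin))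
  (HB.pack_for {linear Defs.total Y n.+1 -> Y n 1}
     p1 (GRing.isLinear.Build _ _ _ _ p1 p1_lin))).
move=> q; rewrite /= /i0 /i1 {1}[q]total_pair_eta.
by rewrite -[total_pair (p0 q) 0]scale1r -total_pairP !scale1r addr0 add0r.
Qed.

Definition total_corner (a : Y 0 0) : Defs.total Y 0 :=
  fun p => match p with
  | exist (i, j) h => match i, j return (i + j == 0)%N -> Y i j with
    | 0, 0 => fun=> a
    | _, _ => fun=> 0
    end h
  end.

Lemma corner_eq (p : antidiagonal 0) : p = corner.
Proof.
by case: p => -[[|i] [|j]] //= h; congr (exist _ _ _); apply: bool_irrelevance.
Qed.

Lemma total0_projective : projective (Y 0 0) -> projective (Defs.total Y 0).
Proof.
pose p0 (y : Defs.total Y 0) := y corner.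
have i0_lin : linear total_corner.
  by move=> c a b; apply: functional_extensionality_dep => p; rewrite (corner_eq p).
have p0_lin : linear p0 by [].
(* The second summand is a dummy with zero maps. *)
move=> Y_proj; apply: (@projective_split S _ (Y 0 0) (Y 0 0)
  (HB.pack_for {linear Y 0 0 -> Defs.total Y 0} total_corner
     (GRing.isLinear.Build _ _ _ _ total_corner i0_lin)) \0
  (HB.pack_for {linear Defs.total Y 0 -> Y 0 0}
     p0 (GRing.isLinear.Build _ _ _ _ p0 p0_lin)) \0) => //.
by move=> q; rewrite /= addr0; apply: functional_extensionality_dep => p;
   rewrite (corner_eq p).
Qed.

Variables (dh : forall i j, Y i.+1 j -> Y i j) (dv : forall i j, Y i j.+1 -> Y i j).

Lemma total_d_linear n :
  (forall i j, linear (@dh i j)) -> (forall i j, linear (@dv i j)) ->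
  linear (@total_d S Y dh dv n).
Proof.
move=> dh_lin dv_lin c y z; apply: functional_extensionality_dep => p.
rewrite /total_d -[RHS]/(c *: (dh (y (up_l p)) + dv (y (up_r p))) +
  (dh (z (up_l p)) + dv (z (up_r p)))).
by rewrite dh_lin dv_lin scalerDr addrACA.
Qed.

Lemma total_d_corner (y : Defs.total Y 1) :
  total_d dh dv y corner = dh (y (antidiag0 0)) + dv (y (antidiag1 0)).
Proof.
by congr (_ + _); [apply: (congr1 (@dh 0 0))|apply: (congr1 (@dv 0 0))]; apply: total_irr.
Qed.

Lemma total_d_antidiag0 n (y : Defs.total Y n.+2) :
  total_d dh dv y (antidiag0 n) = dh (y (antidiag0 n.+1)) + dv (y (antidiag1 n.+1)).
Proof.
by congr (_ + _); [apply: (congr1 (@dh n.+1 0))|apply: (congr1 (@dv n.+1 0))];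
   apply: total_irr.
Qed.

Lemma total_d_antidiag1 n (y : Defs.total Y n.+2) : dv (0 : Y n 2) = 0 ->
  total_d dh dv y (antidiag1 n) = dh (y (antidiag1 n.+1)).
Proof.
move=> dv0; rewrite /total_d (Y_small (y (up_r (antidiag1 n)))) dv0 addr0.
by apply: (congr1 (@dh n 1)); apply: total_irr.
Qed.
End TotalComplex.

(** * Assembly of the resolution *)

Theorem theorem6p6 (k : fieldType) (R : algType k)
    (sigma : {lrmorphism R -> R}) (sigma_bij : bijective sigma)
    (delta : skew_derivation sigma)
    (M : lmodType (ore delta))
    (phi : {linear restrict (oreC delta) M ->
                   restrict sigma (restrict (oreC delta) M)})
    (phi_bij : bijective phi)
    (P : nat -> lmodType R) (d : forall i, {linear P i.+1 -> P i})
    (mu : {linear P 0%N -> restrict (oreC delta) M})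
    (P_res : projective_resolution (fun i => d i) mu)
    (sg : forall i, {linear P i -> restrict sigma (P i)})
    (sg_chain : forall i z, d i (sg i.+1 z) = sg i (d i z))
    (sg_lift : forall z, mu (sg 0%N z) = phi (mu z))
    (sg_bij : forall i, bijective (sg i))
    (dl : forall i, skew_map delta (P i))
    (dl_chain : forall i z, d i (dl i.+1 z) = dl i (d i z))
    (dl_lift : forall z, mu (dl 0%N z) = oreX delta *: (mu z : M)) :
  projective_resolution (@Yd k R sigma delta P d sg dl)
    (@Yaug k R sigma delta P sg dl M mu).
Proof.
case: P_res => P_proj _ mu_surj mu_ker d_ker.
have Y_small i j (y : Yij sg dl i j.+2) : y = 0 by exact: (@thinmx0 (ore delta) 1 y).
have Q_proj i : projective (twisted (sg i) (dl i)).
  have [s' sK s'K] := sg_bij i.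
  have s'B : zmod_morphism s'.
    by move=> a b; apply: (can_inj sK); rewrite s'K linearB /= !s'K.
  pose s'A : {additive P i -> P i} := HB.pack s' (GRing.isZmodMorphism.Build _ _ s' s'B).
  exact: (@twisted_projective k R sigma delta (P i) (sg i) (dl i) s'A).
have Yh_lin i j : linear (@Yh k R sigma delta P d sg dl i j).
  case: j => [|[|j]]; [| |by move=> c y z; rewrite scaler0 addr0];
    by apply: tensor_map_ore_linear => z /=; [apply: sg_chain|apply: dl_chain].
have Yv_lin i j : linear (@Yv k R sigma delta P sg dl i j).
  case: j => [|j]; last by move=> c y z; rewrite scaler0 addr0.
  exact: sign_tensor_map_lmulX_ore_linear.
have vdd0 i z : vspace_map (d i) (vspace_map (d i.+1) z) = 0 by apply/d_ker; exists z.
have vmud0 z : vspace_map mu (vspace_map (d 0) z) = 0 by apply/mu_ker; exists z.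
have vmu_exact z : vspace_map mu z = 0 -> exists w, vspace_map (d 0) w = z
  by apply mu_ker.
have vd_exact i z : vspace_map (d i) z = 0 -> exists w, vspace_map (d i.+1) w = z
  by apply d_ker.
have YdEc (y : Y sg dl 1) : Yd d y corner =
    tensor_map (vspace_map (d 0)) idfun (y (antidiag0 0)) +
    ((-1) ^+ 0 : k) *: tensor_map idfun (lmul 'X) (y (antidiag1 0)).
  exact: total_d_corner.
split.
- case=> [|n]; first exact: (total0_projective (Y := Yij sg dl) (Q_proj 0)).
  exact: (totalS_projective (Y := Yij sg dl) Y_small (Q_proj n.+1) (Q_proj n)).
- split=> [|n]; last exact: total_d_linear.
  by move=> c y z; apply: (tensor_unit_ore_linear dl_lift).
- move=> m; have [z mz] := mu_surj m.
  exists (total_corner (tensor (z : vspace_of R (P 0)) 1 : Yij sg dl 0 0)).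
  rewrite /Yaug /total_aug tensor_unit_map const_coefE hornerC scale1r; exact: mz.
- move=> y; split.
  (* The augmentation is μ of the constant coefficient. *)
  rewrite /Yaug /total_aug tensor_unit_map => /(tprod_aug_exact vmu_exact) [a [b E]].
  exists (total_pair (a : Yij sg dl 1 0) (b : Yij sg dl 0 1)).
    apply: functional_extensionality_dep => p; rewrite (corner_eq p) [LHS]YdEc.
    by rewrite total_pair0 total_pair1 /= scale1r.
  case=> w <-; rewrite /Yaug /total_aug YdEc.
  rewrite tensor_unit_map linearD /= const_coef_map linearZ /= const_coefX.
  by rewrite scaler0 addr0; apply: vmud0.
have YdE0 n (y : Y sg dl n.+2) : Yd d y (antidiag0 n) =
    tensor_map (vspace_map (d n.+1)) idfun (y (antidiag0 n.+1)) +
    ((-1) ^+ n.+1 : k) *: tensor_map idfun (lmul 'X) (y (antidiag1 n.+1)).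
  exact: total_d_antidiag0.
have YdE1 n (y : Y sg dl n.+2) : Yd d y (antidiag1 n) =
    tensor_map (vspace_map (d n)) idfun (y (antidiag1 n.+1)).
  exact: total_d_antidiag1.
(* Degree 1 is separate: its differential lands in degree 0, which has the corner as its only
   entry. *)
case=> [|n] y; split.
- move=> y0; have := congr1 (fun z => z corner) y0; rewrite [X in X = _]YdEc.
  move=> /(@tprod_cone_exact _ _ _ _ _ _ (vd_exact 0) 0) [a [b [Ea Eb]]].
  exists (total_pair (a : Yij sg dl 2 0) (b : Yij sg dl 1 1)).
  rewrite [RHS](total_pair_eta Y_small) [LHS](total_pair_eta Y_small).
  by rewrite YdE0 YdE1 total_pair0 total_pair1 Ea Eb.
- case=> w <-; apply: functional_extensionality_dep => p; rewrite (corner_eq p).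
  rewrite YdEc YdE0 YdE1 expr0 expr1 scale1r scaleN1r.
  by rewrite linearB /= (tensor_map_comp0 (vdd0 0)) sub0r tensor_mapX addNr.
(* The column 0 entry of the cycle equation already determines the column 1 entry of [y]. *)
- move=> y0; have := congr1 (fun z => z (antidiag0 n)) y0; rewrite [X in X = _]YdE0.
  move=> /(@tprod_cone_exact _ _ _ _ _ _ (vd_exact n.+1) n.+1) [a [b [Ea Eb]]].
  exists (total_pair (a : Yij sg dl n.+3 0) (b : Yij sg dl n.+2 1)).
  rewrite [RHS](total_pair_eta Y_small) [LHS](total_pair_eta Y_small).
  by rewrite YdE0 YdE1 total_pair0 total_pair1 Ea Eb.
(* d ⊗ 1 commutes with x, and the signs in consecutive rows are opposite, so the mixed terms
   cancel. *)
case=> w <-; rewrite [LHS](total_pair_eta Y_small) [RHS](total_pair_eta Y_small).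
rewrite !YdE0 !YdE1 (tensor_map_comp0 (vdd0 n)) linearD linearZ /=.
rewrite (tensor_map_comp0 (vdd0 n.+1)) add0r tensor_mapX.
by rewrite [(-1) ^+ n.+2]exprS mulN1r scaleNr addNr.
Qed.
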